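(* Let $F:\mathbb{N}^+\times\mathbb{N}^+\to\mathbb{N}^+$ be defined by $$F(m,n)=\frac{1}{4}\left[(m+n-1)^2-\big((m+n-1)\bmod 2\big)\right]+\min(m,n).$$ Let $S_O=\{(x,y)\in\mathbb{N}^+\times\mathbb{N}^+ : x\ge y\}$. Then the restriction of $F$ to $S_O$ is a bijection from $S_O$ onto $\mathbb{N}^+$.
   Context: $\mathbb{N}^+$ denotes the set of positive integers. For an integer $k$, $k\bmod 2$ denotes the least non-negative residue of $k$ modulo $2$. *)

(* Defs.v *)
From mathcomp Require Import all_boot all_order all_algebra.
From mathcomp Require Import zify.

Set Implicit Arguments.
Unset Strict Implicit.
Unset Printing Implicit Defensive.

Import Order.TTheory GRing.Theory Num.Theory.

Local Open Scope ring_scope.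

Notation Npos := {n : nat | (0 < n)%N}.

Definition F_formula (m n : Npos) : rat :=
  let k : int := (val m)%:Z + (val n)%:Z - 1 in
  1 / 4 * ((k%:~R) ^+ 2 - ((k %% 2)%Z)%:~R) + (minn (val m) (val n))%:R.

Lemma F_formula_Npos (p : Npos * Npos) :
  exists k : Npos, (val k)%:R == F_formula p.1 p.2.
Proof.
case: p => -[m m_gt0] [n n_gt0] /=; rewrite /F_formula /=.
set k : int := m%:Z + n%:Z - 1.
have [q qE] : exists q : nat, k ^+ 2 - (k %% 2)%Z = (4 * q)%:Z.
  have [j jE] : exists j : nat, k = j%:Z by exists (m + n - 1)%N; lia.
  exists (j./2 * (j./2 + odd j))%N; rewrite jE modz_nat modn2 expr2.
  have := odd_double_half j; case: (odd j) => jD; nia.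
have l_gt0 : (0 < q + minn m n)%N by lia.
exists (Sub (q + minn m n)%N l_gt0); rewrite /= natrD; apply/eqP; congr (_ + _).
rewrite -rmorphXn -rmorphB /= qE pmulrn -[RHS]/(1 / 4 * (4 * q)%:R).
by rewrite natrM mulrA mul1r mulVf ?mul1r.
Qed.

(* The value of [F] is the positive integer equal to the rational number
   [F_formula]; see [FE]. *)
Definition F (p : Npos * Npos) : Npos := xchoose (F_formula_Npos p).

Lemma FE (m n : Npos) : (val (F (m, n)))%:R = F_formula m n.
Proof. exact/eqP/(xchooseP (F_formula_Npos (m, n))). Qed.

Definition S_O : {pred Npos * Npos} := [pred p | (val p.1 >= val p.2)%N].

(* Main.v *)
(** On [S_O] write [k = x + y - 1].  Then [F (x, y) = floor (k^2 / 4) + y], where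
    [y] ranges over [1 .. floor ((k + 1) / 2)]; since
    [floor ((k + 1)^2 / 4) - floor (k^2 / 4) = floor ((k + 1) / 2)], these values
    fill the gap between two consecutive quarter-squares exactly once. *)
Require Import Defs.
From mathcomp Require Import all_boot all_order all_algebra.
From mathcomp Require Import zify.

Import GRing.Theory Num.Theory.

(** This is floor(k^2 / 4), written as the product of the two halves of [k]. *)
Definition quarter_square (k : nat) : nat := k./2 * uphalf k.

Lemma quarter_squareS k : quarter_square k.+1 = quarter_square k + uphalf k.
Proof. by rewrite /quarter_square /= mulnS addnC mulnC. Qed.

(** Used to rewrite the bracket of [F_formula] as four times a quarter-square. *)
Lemma quarter_square_mul4 k : 4 * quarter_square k + odd k = k ^ 2.
Proof.
rewrite /quarter_square uphalf_half expnS expn1.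
by have := odd_double_half k; case: (odd k) => kE; nia.
Qed.

Lemma leq_quarter_square : {homo quarter_square : j k / j <= k}.
Proof.
move=> j k le_jk; apply: leq_mul; first exact: half_leq.
exact: uphalf_leq.
Qed.

Lemma quarter_square_gap v :
  0 < v -> exists k, quarter_square k < v <= quarter_square k.+1.
Proof.
move=> v_gt0; have ex_k : exists k, v <= quarter_square k.
  (* The quarter-square of [v.*2] is [v * v]. The least index reaching [v] is not 0, so it has a
     predecessor, the required [k]. *)
  by exists v.*2; rewrite /quarter_square doubleK uphalf_double leq_pmulr.
case: (ex_minnP ex_k) => -[|k] le_v min_k; first by rewrite leqNgt v_gt0 in le_v.
by exists k; rewrite le_v andbT ltnNge; apply/negP => /min_k; rewrite ltnn.
Qed.

(** If j < k, monotonicity would give v <= Q(j+1) <= Q(k) < v, with Q the quarter-square. *)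
Lemma quarter_square_gap_inj v j k :
  quarter_square j < v <= quarter_square j.+1 ->
  quarter_square k < v <= quarter_square k.+1 -> j = k.
Proof.
move=> /andP[lt_j le_j] /andP[lt_k le_k].
have [lt_jk|lt_kj|//] := ltngtP j k.
- by have := leq_quarter_square _ _ lt_jk; lia.
- by have := leq_quarter_square _ _ lt_kj; lia.
Qed.

Lemma val_F (m n : Npos) :
  val (F (m, n)) = quarter_square (val m + val n).-1 + minn (val m) (val n).
Proof.
apply/eqP; rewrite -(eqr_nat rat) FE; apply/eqP; case: m n => [m m_gt0] [n n_gt0].
rewrite /F_formula /= natrD; congr (_ + _)%R.
(* The truncated predecessor agrees with integer subtraction because [m] and [n] are positive. *)
have -> : (m%:Z + n%:Z - 1 = (m + n).-1%:Z)%R by lia.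
set k := (m + n).-1; rewrite modz_nat modn2 -!pmulrn -natrX -quarter_square_mul4.
by rewrite natrD addrK natrM mulrA mul1r mulVf ?mul1r.
Qed.

Lemma val_F_S_O p : p \in S_O ->
  val (F p) = quarter_square (val p.1 + val p.2).-1 + val p.2.
Proof. by case: p => m n; rewrite inE val_F => /minn_idPr ->. Qed.

(** The lower bound is strict as y >= 1; the upper one holds because y <= x gives 2y <= x + y = k +
    1. *)
Lemma val_F_gap p (k := (val p.1 + val p.2).-1) : p \in S_O ->
  quarter_square k < val (F p) <= quarter_square k.+1.
Proof.
move=> p_in; rewrite val_F_S_O // quarter_squareS -/k.
move: p_in; rewrite inE /k; have := valP p.2; case: (val p.2) => //= y _; lia.
Qed.

Lemma F_inj_S_O : {in S_O &, injective F}.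
Proof.
move=> p q p_in q_in eqF.
have gap_p := val_F_gap p p_in; have gap_q := val_F_gap q q_in.
rewrite eqF in gap_p; have eq_k := quarter_square_gap_inj _ _ _ gap_p gap_q.
have := congr1 val eqF; rewrite !val_F_S_O // eq_k => /addnI eq2.
(* Positivity is what lets equal predecessors of the sums give equal sums. *)
have := valP p.1; have := valP q.1 => q1_gt0 p1_gt0.
case: p q {p_in q_in eqF gap_p gap_q} eq_k eq2 q1_gt0 p1_gt0 => [m n] [m' n'] /=.
by move=> eq_k eq2 m'_gt0 m_gt0; congr (_, _); apply: val_inj => /=; lia.
Qed.

Lemma F_surj_S_O v : exists2 p, p \in S_O & F p = v.
Proof.
have [k /andP[lt_v]] := quarter_square_gap _ (valP v).
rewrite quarter_squareS uphalfE => le_v.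
(* The offset of [v] in its gap must be y, and x + y - 1 = k then forces x = k + 1 - y. *)
pose y := val v - quarter_square k.
have y_gt0 : 0 < y by rewrite subn_gt0.
have x_gt0 : 0 < k.+1 - y by rewrite /y; lia.
have p_in : (Sub (k.+1 - y) x_gt0 : Npos, Sub y y_gt0 : Npos) \in S_O.
  by rewrite inE /= /y; lia.
exists (Sub (k.+1 - y) x_gt0 : Npos, Sub y y_gt0 : Npos) => //.
apply: val_inj; rewrite val_F_S_O //= subnK /=; last by rewrite /y; lia.
by rewrite subnKC // ltnW.
Qed.

Theorem theorem3 :
  bijective (fun p : {p : Npos * Npos | p \in S_O} => F (val p)).
Proof.
(* Surjectivity yields a right inverse by choice; injectivity makes it a left inverse too. *)
have ex_pre v : exists p : {p : Npos * Npos | p \in S_O}, F (val p) == v.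
  by have [p p_in <-] := F_surj_S_O v; exists (Sub p p_in).
have gK v : F (val (xchoose (ex_pre v))) = v by apply/eqP/(xchooseP (ex_pre v)).
exists (fun v => xchoose (ex_pre v)) => // p.
by apply/val_inj/F_inj_S_O; rewrite ?gK //; apply: valP.
Qed.
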